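(* Let $n \geq 1$ be an integer, let $p_n = p_n(z;x,y)$ be the symmetric homogeneous polynomial of degree $n$ with integer coefficients given by $$p_n(z;x,y) = \prod_{r=1}^n \left(z - \left(\sqrt[n]{(-1)^n x} + \epsilon^r \sqrt[n]{(-1)^n y}\right)^n\right),$$ where $\epsilon$ is a primitive $n$-th root of unity, and write $$p_n = \sum_{\substack{k_1 \geq k_2 \geq k_3 \geq 0\\ k_1+k_2+k_3 = n}} A_{k_1,k_2,k_3}\, e_1^{k_1-k_2} e_2^{k_2-k_3} e_3^{k_3}, \qquad A_{k_1,k_2,k_3} \in \mathbb{Z},$$ where $e_1 = x+y+z$, $e_2 = xy+yz+zx$, $e_3 = xyz$. 1) If $n$ is odd, then $A_{k_1,k_2,0} = 0$ for all $k_1 \geq k_2 > 0$ with $k_1+k_2 = n$; that is, $p_n$, as a polynomial in $e_1,e_2,e_3$, contains no monomials $e_1^i e_2^j$ with $j>0$. 2) If $n = 2k$ is even, then the coefficient $A_{2k-i,i,0}$ at $e_1^{2(k-i)} e_2^i$ is equal to $$A_{2k-i,i,0} = (-4)^i \binom{k}{i} = (-4)^i \frac{k!}{i!\,(k-i)!}, \qquad i = 1, 2, \ldots, k.$$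
   Context: The $n$-valued group structure on $\mathbb{C}$ has multiplication given by the multiset $x*y = [(\sqrt[n]{x} + \epsilon^r \sqrt[n]{y})^n : 1 \leq r \leq n]$, where $\epsilon$ is a primitive $n$-th root of unity (the multiset does not depend on the choice of the $n$-th roots), with unit $0$ and inverse $\mathrm{inv}(x) = (-1)^n x$. The polynomial $p_n$ is $p_n(z;x,y) = \prod_{r=1}^n (z - (\mathrm{inv}(x)*\mathrm{inv}(y))_r)$, where $(u*v)_r$ denotes the $r$-th element of the multiset $u*v$; this is the product displayed in the claim. It is known that $p_n$ is a homogeneous polynomial of degree $n$ in $x,y,z$, symmetric in $x,y,z$, with integer coefficients; hence it is uniquely a polynomial with integer coefficients in the elementary symmetric polynomials $e_1,e_2,e_3$, which defines the integers $A_{k_1,k_2,k_3}$. *)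

(* Defs.v *)
From HB Require Import structures.
From mathcomp Require Import all_boot all_order all_algebra.
From mathcomp Require Import reals complex mpoly.

Set Implicit Arguments.
Unset Strict Implicit.
Unset Printing Implicit Defensive.

Import Order.TTheory GRing.Theory Num.Theory.
Local Open Scope ring_scope.

(* [n.-root] is one particular choice of n-th root on R[i]; any other choice
   only permutes the factors, since [eps] is a primitive n-th root of unity. *)
Definition pn_value (R : realType) (n : nat) (eps x y z : R[i]) : R[i] :=
  \prod_(1 <= r < n.+1)
    (z - (n.-root ((-1) ^+ n * x) + eps ^+ r * n.-root ((-1) ^+ n * y)) ^+ n).

(* The variables 'X_0, 'X_1, 'X_2 stand for x, y, z respectively. *)
Definition is_pn (R : realType) (n : nat) (eps : R[i]) (p : {mpoly int[3]}) :
    Prop :=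
  [/\ p \is symmetric,
      p \is n.-homog
    & forall x y z : R[i],
        (map_mpoly intr p).@[tnth [tuple x; y; z]] = pn_value n eps x y z].

Definition e_ (k : nat) : {mpoly int[3]} := mesym 3 int k.

Definition is_e_expansion (n : nat) (p : {mpoly int[3]})
    (A : nat -> nat -> nat -> int) : Prop :=
  p = \sum_(k1 < n.+1) \sum_(k2 < n.+1)
        \sum_(k3 < n.+1 | (k3 <= k2 <= k1)%N && (k1 + k2 + k3 == n)%N)
          A k1 k2 k3 *:
            (e_ 1 ^+ (k1 - k2) * e_ 2 ^+ (k2 - k3) * e_ 3 ^+ k3).

(* Main.v *)
Require Import Defs.
From HB Require Import structures.
From mathcomp Require Import all_boot all_order all_algebra.
From mathcomp Require Import reals complex mpoly.
From mathcomp Require Import ring zify.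

Set Implicit Arguments.
Unset Strict Implicit.
Unset Printing Implicit Defensive.

Import Order.TTheory GRing.Theory Num.Theory.
Local Open Scope ring_scope.

(** The coefficients [A k1 k2 0] are those that survive setting [e_3 = 0], that
    is, setting one of the three variables to zero.  At [y = 0] all the factors
    of the product coincide, since the n-th root of [y] disappears, and
      [p_n = (z - (-1)^n x)^n].
    As [e_1 = x + z] and [e_2 = x z] there, this is [e_1^n] for [n] odd, and
    [((x + z)^2 - 4 x z)^k = (e_1^2 - 4 e_2)^k] for [n = 2 k]; the binomial
    theorem then gives the coefficients.

    By homogeneity nothing is lost by also setting [e_1 = 1], which turns the
    comparison of coefficients into one between polynomials in the single
    variable [q = e_2]: the polynomial [e3_free_part] on one side, [1] or
    [(1 - 4 q)^k] on the other.  Every complex [q] is of the form [x z] with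
    [x + z = 1], so these polynomials agree at every point
    ([e3_free_part_horner]), hence are equal. *)

Lemma poly_pointwise_eq (F : numDomainType) (p q : {poly F}) :
  (forall x, p.[x] = q.[x]) -> p = q.
Proof.
move=> pq; apply/eqP; rewrite -subr_eq0; apply: contraT => nz.
pose s := [seq i%:R : F | i <- iota 0 (size (p - q)%R)].
have: (size s < size (p - q)%R)%N.
  apply: max_poly_roots nz _ _.
    by apply/allP=> x _; rewrite /root hornerD hornerN pq subrr.
  by rewrite map_inj_uniq ?iota_uniq // => i j /eqP; rewrite eqr_nat => /eqP.
by rewrite size_map size_iota ltnn.
Qed.

Lemma map_mpoly_mesym (S : nzRingType) (n k : nat) :
  map_mpoly intr (mesym n int k) = mesym n S k.
Proof.
by apply/mpolyP=> m; rewrite mcoeff_map_mpoly !mcoeff_mesym; case: mechar.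
Qed.

(** By Viete's formulas the values of the elementary symmetric polynomials at
    [(x, 0, z)] are, up to sign, the coefficients of ['X * ('X - x) * ('X - z)],
    that is, of ['X^3 - 'X^2 + x z 'X] when [x + z = 1]. *)
Lemma e_values (S : idomainType) (x z : S) (k : 'I_4) : x + z = 1 ->
  (map_mpoly intr (e_ k)).@[tnth [tuple x; 0; z]]
    = [:: 1; 1; x * z; 0]`_k.
Proof.
move=> xz1; rewrite map_mpoly_mesym.
apply: (mulrI (_ : (-1) ^+ k \is a GRing.unit)).
  by rewrite unitrX ?unitrN1.
rewrite -mroots_coeff !big_cons big_nil subr0 mulr1.
have ->: ('X - x%:P) * ('X * ('X - z%:P))
    = 'X^3 - 'X^2 + (x * z) *: 'X :> {poly S}.
  transitivity ('X^3 - (x + z)%:P * 'X^2 + (x * z)%:P * 'X : {poly S}).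
    by rewrite rmorphD rmorphM /=; ring.
  by rewrite xz1 mul1r mul_polyC.
by case: k => [[|[|[|[|//]]]] hk] /=;
  rewrite !(coefD, coefN, coefZ, coefXn, coefX) /=; ring.
Qed.

(** The specialization [e_1 = 1], [e_2 = 'X], [e_3 = 0] of the expansion with
    coefficients [A].  An index [i] with [i > n - i] does not occur in that
    expansion, and the value of [A] there is arbitrary; hence the cutoff. *)
Definition e3_free_part (n : nat) (A : nat -> nat -> nat -> int) : {poly int} :=
  \poly_(i < n.+1) if (i.*2 <= n)%N then A (n - i)%N i 0%N else 0.

Lemma e3_free_part_horner (S : idomainType) (n : nat) (p : {mpoly int[3]})
    (A : nat -> nat -> nat -> int) (x z : S) :
  is_e_expansion n p A -> x + z = 1 ->
  (map_mpoly intr p).@[tnth [tuple x; 0; z]]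
    = (map_poly intr (e3_free_part n A)).[x * z].
Proof.
move=> -> xz1.
pose phi : {rmorphism {mpoly int[3]} -> S} :=
  meval (tnth [tuple x; 0; z]) \o map_mpoly intr.
have e1 : phi (e_ 1) = 1 := e_values (@Ordinal 4 1 isT) xz1.
have e2 : phi (e_ 2) = x * z := e_values (@Ordinal 4 2 isT) xz1.
have e3 : phi (e_ 3) = 0 := e_values (@Ordinal 4 3 isT) xz1.
have phiZ (a : int) m : phi (a *: m) = a%:~R * phi m.
  by rewrite /phi /= map_mpolyZ mevalZ.
rewrite -[LHS]/(phi _); clearbody phi.
rewrite exchange_big /e3_free_part poly_def.
rewrite !rmorph_sum /= horner_sum.
apply: eq_bigr => k2 _; rewrite rmorph_sum /=.
(* Only [k3 = 0] survives [e_3 = 0], leaving [c k1]; then only [k1 = n - k2]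
   meets the degree condition. *)
pose c k1 : S := if (k2 <= k1)%N && (k1 + k2 == n)%N
  then (A k1 k2 0%N)%:~R * (x * z) ^+ k2 else 0.
transitivity (\sum_(k1 < n.+1) c k1).
  apply: eq_bigr => k1 _; rewrite rmorph_sum /= big_mkcond big_ord_recl /=.
  rewrite addn0 big1 ?addr0 => [|k3 _].
    rewrite /c; case: ifP => // _; rewrite subn0 expr0 mulr1.
    by rewrite phiZ !rmorphM !rmorphXn /= e1 e2 expr1n mul1r.
  case: ifP => // _; rewrite phiZ !rmorphM !rmorphXn /= e3.
  by rewrite expr0n !mulr0.
have [le2|gt2] := leqP k2.*2 n; last first.
  rewrite scale0r rmorph0 horner0 big1 // => k1 _; rewrite /c ifF //.
  by apply/negbTE; lia.
have kn : (n - k2 < n.+1)%N by lia.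
rewrite (bigD1 (Ordinal kn)) //= big1 ?addr0 => [|k1 /eqP ne]; last first.
  rewrite /c ifF //; apply/negP => /andP[_ /eqP eqn]; apply: ne.
  by apply: val_inj => /=; lia.
rewrite /c ifT; last by lia.
by rewrite map_polyZ /= map_polyXn hornerZ hornerXn.
Qed.

Lemma pn_value_y0 (R : realType) (n : nat) (eps x z : R[i]) : (0 < n)%N ->
  pn_value n eps x 0 z = (z - (-1) ^+ n * x) ^+ n.
Proof.
move=> n_gt0; rewrite /pn_value.
under eq_bigr => r _ do rewrite mulr0 rootC0 mulr0 addr0 rootCK //.
by rewrite prodr_const_nat subn1.
Qed.

Lemma sum_product_parametrization (C : numClosedFieldType) (q : C) :
  exists x z, x + z = 1 /\ x * z = q.
Proof.
exists ((1 + sqrtC (1 - 4 * q)) / 2), ((1 - sqrtC (1 - 4 * q)) / 2).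
split; first by field.
transitivity ((1 - sqrtC (1 - 4 * q) ^+ 2) / 4); first by field.
by rewrite sqrtCK; field.
Qed.

Lemma map_intr_poly_inj (F : numDomainType) :
  injective (map_poly intr : {poly int} -> {poly F}).
Proof. by apply: map_inj_poly; [exact: intr_inj | rewrite rmorph0]. Qed.

(** Transfers an identity for [p_n] on the plane [x + z = 1], [y = 0] to the
    integer polynomial in [q = x z] that it encodes. *)
Lemma e3_free_partP (R : realType) (n : nat) (eps : R[i]) (p : {mpoly int[3]})
    (A : nat -> nat -> nat -> int) (f : {poly int}) :
  (0 < n)%N -> is_pn n eps p -> is_e_expansion n p A ->
  (forall x z : R[i], x + z = 1 ->
     (z - (-1) ^+ n * x) ^+ n = (map_poly intr f).[x * z]) ->
  e3_free_part n A = f.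
Proof.
move=> n_gt0 [_ _ pE] pA fE; apply: (@map_intr_poly_inj R[i]).
apply: poly_pointwise_eq => q.
have [x [z [xz1 <-]]] := sum_product_parametrization q.
by rewrite -(e3_free_part_horner pA xz1) pE pn_value_y0 // fE.
Qed.

Lemma coef_e3_free_part (n i : nat) (A : nat -> nat -> nat -> int) :
  (i.*2 <= n)%N -> (e3_free_part n A)`_i = A (n - i)%N i 0%N.
Proof. by move=> le2; rewrite coef_poly le2 ifT //; lia. Qed.

Lemma coef_1DcX_exp (S : comNzRingType) (c : S) (k i : nat) : (i <= k)%N ->
  ((1 + c *: 'X) ^+ k)`_i = c ^+ i * 'C(k, i)%:R.
Proof.
move=> le_ik; rewrite exprDn coef_sum.
rewrite (bigD1 (Ordinal (le_ik : (i < k.+1)%N))) //= big1 ?addr0 => [|j ne].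
  by rewrite expr1n mul1r coefMn exprZn coefZ coefXn eqxx mulr1 mulr_natr.
rewrite expr1n mul1r coefMn exprZn coefZ coefXn.
by rewrite [i == j]eq_sym (negbTE (ne : val j != i)) mulr0 mul0rn.
Qed.

Theorem proposition3p1 (R : realType) (n : nat) (eps : R[i])
    (p : {mpoly int[3]}) (A : nat -> nat -> nat -> int)
    (n_ge1 : (1 <= n)%N)
    (eps_prim : n.-primitive_root eps)
    (p_pn : is_pn n eps p)
    (p_A : is_e_expansion n p A) :
  (odd n ->
     forall k1 k2 : nat, (0 < k2)%N -> (k2 <= k1)%N -> (k1 + k2 = n)%N ->
       A k1 k2 0%N = 0)
  /\
  (forall k : nat, n = (2 * k)%N ->
     forall i : nat, (1 <= i)%N -> (i <= k)%N ->
       A (2 * k - i)%N i 0%N = (-4) ^+ i * ('C(k, i))%:Z /\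
       (-4) ^+ i * ('C(k, i))%:Z
         = (-4) ^+ i * (k`! %/ (i`! * (k - i)`!))%:Z :> int).
Proof.
split=> [n_odd k1 k2 k2_gt0 le21 k12 | k n2k i i_ge1 le_ik].
  have part1 : e3_free_part n A = 1.
    apply: (e3_free_partP n_ge1 p_pn p_A) => x z xz1.
    by rewrite -signr_odd n_odd mulN1r opprK addrC xz1 expr1n rmorph1 hornerC.
  have -> : k1 = (n - k2)%N by lia.
  by rewrite -coef_e3_free_part ?part1 ?coef1 ?gtn_eqF //; lia.
have partE : e3_free_part n A = (1 + (-4) *: 'X) ^+ k.
  apply: (e3_free_partP n_ge1 p_pn p_A) => x z xz1.
  rewrite -signr_odd n2k oddM /= expr0 mul1r exprM rmorphXn horner_exp.
  rewrite rmorphD rmorph1 /= map_polyZ /= map_polyX hornerD hornerC hornerZ.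
  rewrite hornerX; congr (_ ^+ k).
  have ->: (z - x) ^+ 2 = (x + z) ^+ 2 - 4 * (x * z) by ring.
  by rewrite xz1 expr1n rmorphN /= mulNr.
split; last by rewrite bin_factd //; lia.
rewrite -n2k -coef_e3_free_part; last by lia.
by rewrite partE coef_1DcX_exp // -[in RHS]natz.
Qed.
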